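(* Let $k\subset K$ be a finite Galois extension of fields of degree $n>2$ with Galois group $G=\mathrm{Aut}_k(K)$. Let $\mathscr{G}$ be the finite étale $k$-group scheme with $\mathscr{G}(L)=\mathrm{Aut}_L(L\otimes_kK)$ for $k$-algebras $L$, let $k_s$ be a separable closure of $k$ and $\Gamma=\mathrm{Gal}(k_s/k)$, acting on $\mathscr{G}(k_s)$ by $\sigma\cdot\varphi=(\sigma\otimes1)\circ\varphi\circ(\sigma\otimes1)^{-1}$. View $G\subseteq\mathscr{G}(k_s)$ via $g\mapsto 1\otimes g$ (so $G=\mathscr{G}(k)=\mathscr{G}(k_s)^\Gamma$). Let $\underline{G}\subseteq\mathscr{G}$ be the finite étale $k$-subgroup scheme whose group of $k_s$-points is the centralizer $C_{\mathscr{G}(k_s)}(G)$ (a $\Gamma$-stable subgroup), with the restricted $\Gamma$-action. Let $X=\mathrm{Spec}_k(K)$, on which $\mathscr{G}$ acts naturally. Then the restricted action $\underline{G}\times_kX\to X$ makes $X$ into a principal homogeneous space (torsor) for $\underline{G}$.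
   Context: The natural action of $\mathscr{G}$ on $X=\mathrm{Spec}_k(K)$ is given on $L$-points by letting $\mathrm{Aut}_L(L\otimes_kK)$ act on $X(L)=\mathrm{Hom}_{L\text{-alg}}(L\otimes_kK,L)$ via $\varphi\cdot x=x\circ\varphi^{-1}$. Finite étale $k$-group schemes correspond to finite groups with a continuous $\Gamma$-action (their $k_s$-points). $X$ is a principal homogeneous space for $\underline{G}$ if $X$ is nonempty and the morphism $\underline{G}\times_kX\to X\times_kX$, $(g,x)\mapsto(gx,x)$, is an isomorphism. *)

(* Defs.v *)
From HB Require Import structures.
From mathcomp Require Import all_boot all_order all_algebra all_field.
From mathcomp Require Import boolp classical_sets functions.

Set Implicit Arguments.
Unset Strict Implicit.
Unset Printing Implicit Defensive.

Import GRing.Theory.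
Local Open Scope ring_scope.

Section AlgebraMorphisms.
Variables (R : comNzRingType) (A B C : comAlgType R).

Lemma lrmorphism_inj (f g : {lrmorphism A -> B}) : f =1 g -> f = g.
Proof.
case: f g => [f [[f1] [f2] [f3]]] [g [[g1] [g2] [g3]]] /= /funext fg.
move: f1 f2 f3 g1 g2 g3; rewrite fg => *.
congr GRing.LRMorphism.Pack; congr GRing.LRMorphism.Class;
  congr (_ _); exact: Prop_irrelevance.
Qed.

Definition lrcomp (g : {lrmorphism B -> C}) (f : {lrmorphism A -> B}) :
  {lrmorphism A -> C} := g \o f.

End AlgebraMorphisms.

Record algAut (R : comNzRingType) (T : comAlgType R) := AlgAut {
  aut_fun :> {lrmorphism T -> T};
  aut_inv : {lrmorphism T -> T};
  aut_funK : cancel aut_fun aut_inv;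
  aut_invK : cancel aut_inv aut_fun }.

Section AlgAutGroup.
Variables (R : comNzRingType) (T : comAlgType R).
Implicit Types f g : algAut T.

Lemma algAut_inj f g : f =1 g -> f = g.
Proof.
case: f g => [f f' fK f'K] [g g' gK g'K] /= fg.
have e : f = g by apply: lrmorphism_inj.
have e' : f' = g'.
  by apply: lrmorphism_inj => x; rewrite -[x in LHS]g'K -fg fK.
move: fK f'K gK g'K; rewrite e e' => *; congr AlgAut; exact: Prop_irrelevance.
Qed.

Definition aut_one : algAut T :=
  @AlgAut R T (idfun : {lrmorphism T -> T}) idfun
    (fun=> erefl) (fun=> erefl).
Definition aut_mul f g : algAut T :=
  AlgAut (can_comp (@aut_funK _ _ f) (@aut_funK _ _ g)
            : cancel (lrcomp f g) (lrcomp (aut_inv g) (aut_inv f)))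
         (can_comp (@aut_invK _ _ g) (@aut_invK _ _ f)).
Definition aut_V f : algAut T := AlgAut (@aut_invK _ _ f) (@aut_funK _ _ f).

HB.instance Definition _ := gen_eqMixin (algAut T).
HB.instance Definition _ := gen_choiceMixin (algAut T).

Lemma aut_mulA : associative aut_mul.
Proof. by move=> f g h; apply: algAut_inj. Qed.
Lemma aut_mul1 : left_id aut_one aut_mul.
Proof. by move=> f; apply: algAut_inj. Qed.
Lemma aut_mulr1 : right_id aut_one aut_mul.
Proof. by move=> f; apply: algAut_inj. Qed.
Lemma aut_mulV : left_inverse aut_one aut_V aut_mul.
Proof. by move=> f; apply: algAut_inj => x /=; rewrite aut_funK. Qed.
Lemma aut_mulrV : right_inverse aut_one aut_V aut_mul.
Proof. by move=> f; apply: algAut_inj => x /=; rewrite aut_invK. Qed.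

End AlgAutGroup.

HB.instance Definition _ (R : comNzRingType) (T : comAlgType R) :=
  isGroup.Build (algAut T) (@aut_mulA R T) (@aut_mul1 R T) (@aut_mulr1 R T)
    (@aut_mulV R T) (@aut_mulrV R T).

Section Tensor.
Variables (k : fieldType) (L : comAlgType k) (K : fieldExtType k).

Let n := \dim {:K}.
Let e : n.-tuple K := vbasis {:K}.

(* L (x)_k K, in coordinates over L with respect to the basis 1 (x) e_i, where
   (e_i) is a k-basis of K; tensorP is the universal property. *)
Definition tensor : Type := 'rV[L]_n.

HB.instance Definition _ := GRing.Lmodule.on tensor.

Definition pure (a : L) (b : K) : tensor := \row_i (coord e i b *: a).

Let sum_coord b : \sum_i coord e i b *: e`_i = b.
Proof. by rewrite -coord_vbasis ?memvf. Qed.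

Lemma pureDl a a' b : pure (a + a') b = pure a b + pure a' b.
Proof. by apply/rowP => i; rewrite !mxE scalerDr. Qed.
Lemma pureDr a b b' : pure a (b + b') = pure a b + pure a b'.
Proof. by apply/rowP => i; rewrite !mxE linearD scalerDl. Qed.
Lemma pureZr c a b : pure a (c *: b) = pure (c *: a) b.
Proof. by apply/rowP => i; rewrite !mxE linearZ /= scalerA mulrC. Qed.
Lemma pureZl (c a : L) b : pure (c * a) b = c *: pure a b.
Proof. by apply/rowP => i; rewrite !mxE scalerAr. Qed.
Lemma pure1l a b : pure a b = a *: pure 1 b.
Proof. by rewrite -pureZl mulr1. Qed.
Lemma pure_suml I r (P : pred I) (F : I -> L) b :
  pure (\sum_(i <- r | P i) F i) b = \sum_(i <- r | P i) pure (F i) b.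
Proof.
apply: (big_morph (pure^~ b)) => [x y|]; first exact: pureDl.
by apply/rowP => i; rewrite !mxE scaler0.
Qed.
Lemma pure_sumr I r (P : pred I) a (F : I -> K) :
  pure a (\sum_(i <- r | P i) F i) = \sum_(i <- r | P i) pure a (F i).
Proof.
apply: (big_morph (pure a)) => [x y|]; first exact: pureDr.
by apply/rowP => i; rewrite !mxE linear0 scale0r.
Qed.

Lemma tensor_sum (z : tensor) : z = \sum_i z 0 i *: pure 1 e`_i.
Proof.
apply/rowP => j; rewrite summxE (bigD1 j) //= big1 => [|i /negPf ij].
  by rewrite !mxE coord_free ?(basis_free (vbasisP _)) // eqxx scale1r mulr1 addr0.
by rewrite !mxE coord_free ?(basis_free (vbasisP _)) // ij scale0r mulr0.
Qed.

Definition tensor_mul (x y : tensor) : tensor :=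
  \sum_i \sum_j pure (x 0 i * y 0 j) (e`_i * e`_j).

Lemma tensor_mul_pure a b a' b' :
  tensor_mul (pure a b) (pure a' b') = pure (a * a') (b * b').
Proof.
rewrite -[b in RHS]sum_coord -[b' in RHS]sum_coord mulr_suml pure_sumr.
apply: eq_bigr => i _; rewrite mulr_sumr pure_sumr; apply: eq_bigr => j _.
rewrite !mxE -!scalerAl -!scalerAr !pureZr.
by rewrite !scalerA mulrC.
Qed.

Lemma tensor_mulC : commutative tensor_mul.
Proof.
move=> x y; rewrite /tensor_mul exchange_big; apply: eq_bigr => i _.
by apply: eq_bigr => j _; rewrite mulrC [X in pure _ X]mulrC.
Qed.
Lemma tensor_mulDl : left_distributive tensor_mul +%R.
Proof.
move=> x y z; rewrite -big_split; apply: eq_bigr => i _ /=.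
by rewrite -big_split; apply: eq_bigr => j _ /=; rewrite mxE mulrDl pureDl.
Qed.
Lemma tensor_mulZl a x y : tensor_mul (a *: x) y = a *: tensor_mul x y.
Proof.
rewrite scaler_sumr; apply: eq_bigr => i _; rewrite scaler_sumr.
by apply: eq_bigr => j _; rewrite mxE -mulrA pureZl.
Qed.
Lemma tensor_mulZr a x y : tensor_mul x (a *: y) = a *: tensor_mul x y.
Proof. by rewrite tensor_mulC tensor_mulZl tensor_mulC. Qed.

Lemma tensor_ind (P : tensor -> Prop) :
    (forall b, P (pure 1 b)) -> (forall a x, P x -> P (a *: x)) ->
    (forall x y, P x -> P y -> P (x + y)) -> forall x, P x.
Proof.
move=> P1 PZ PD x; rewrite [x]tensor_sum; elim/big_ind: _ => [||i _] //.
  by have := PZ 0 _ (P1 0); rewrite scale0r.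
exact/PZ/P1.
Qed.

Lemma tensor_mulA : associative tensor_mul.
Proof.
have DR : right_distributive tensor_mul +%R.
  by move=> a b c; rewrite tensor_mulC tensor_mulDl !(tensor_mulC a).
move=> x y z; elim/tensor_ind: x => [b|a x IH|x x' IH IH'].
- elim/tensor_ind: y => [b'|a y IH|y y' IH IH'].
  + elim/tensor_ind: z => [c|a z IH|z z' IH IH'].
    * by rewrite !tensor_mul_pure !mulrA.
    * by rewrite !tensor_mulZr IH.
    * by rewrite !DR IH IH'.
  + by rewrite tensor_mulZl !tensor_mulZr tensor_mulZl IH.
  + by rewrite tensor_mulDl !DR tensor_mulDl IH IH'.
- by rewrite !tensor_mulZl IH.
- by rewrite !tensor_mulDl IH IH'.
Qed.
Lemma tensor_mul1 : left_id (pure 1 1) tensor_mul.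
Proof.
move=> x; elim/tensor_ind: x => [b|a x IH|x x' IH IH'].
- by rewrite tensor_mul_pure !mul1r.
- by rewrite tensor_mulZr IH.
- by rewrite tensor_mulC tensor_mulDl !(tensor_mulC _ (pure 1 1)) IH IH'.
Qed.
Lemma tensor_oner_neq0 : pure 1 1 != 0.
Proof.
apply/eqP => /rowP p0; have: (1 : K) != 0 by exact: oner_neq0.
rewrite -(sum_coord 1) big1 ?eqxx // => i _.
have := p0 i; rewrite !mxE; have [->|ci] := eqVneq (coord e i 1) 0.
  by rewrite !scale0r.
move=> c0; have /eqP[] := oner_neq0 L.
by rewrite -[1](scalerK ci) c0 scaler0.
Qed.

HB.instance Definition _ := GRing.Zmodule_isComNzRing.Build tensor
  tensor_mulA tensor_mulC tensor_mul1 tensor_mulDl tensor_oner_neq0.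

Lemma tensor_scaleAl (a : L) (x y : tensor) : a *: (x * y) = (a *: x) * y.
Proof. by rewrite [RHS]tensor_mulZl. Qed.

HB.instance Definition _ :=
  GRing.Lmodule_isLalgebra.Build L tensor tensor_scaleAl.
HB.instance Definition _ := GRing.Lalgebra_isComAlgebra.Build L tensor.

Lemma pureM a a' b b' : pure (a * a') (b * b') = pure a b * pure a' b'.
Proof. by rewrite -tensor_mul_pure. Qed.
Lemma pure11 : pure 1 1 = 1. Proof. by []. Qed.
Lemma pure1M b b' : pure 1 (b * b') = pure 1 b * pure 1 b'.
Proof. by rewrite -pureM mulr1. Qed.

End Tensor.

Section TensorUniversal.
Variables (k : fieldType) (L : comAlgType k) (K : fieldExtType k).
Variables (M : comAlgType L) (u : K -> M).
Hypotheses (uD : {morph u : b b' / b + b'}) (u1 : u 1 = 1)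
  (uM : {morph u : b b' / b * b'}) (uZ : forall c b, u (c *: b) = c%:A *: u b).

Definition tensor_lift_fun (z : tensor L K) : M :=
  \sum_i z 0 i *: u (vbasis {:K})`_i.

Let liftD : {morph tensor_lift_fun : x y / x + y}.
Proof.
move=> x y; rewrite /tensor_lift_fun -big_split; apply: eq_bigr => i _ /=.
by rewrite mxE scalerDl.
Qed.

Let liftZ a : {morph tensor_lift_fun : x / a *: x}.
Proof.
move=> x; rewrite /tensor_lift_fun scaler_sumr; apply: eq_bigr => i _ /=.
by rewrite mxE scalerA.
Qed.

Let lift_pure1 b : tensor_lift_fun (pure 1 b) = u b.
Proof.
rewrite [b in RHS](coord_vbasis (memvf b)).
have u0 : u 0 = 0 by rewrite -(scale0r (0 : K)) uZ !scale0r.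
rewrite (big_morph u uD u0); apply: eq_bigr => i _.
by rewrite uZ mxE.
Qed.

Let lift_is_zmod_morphism : zmod_morphism tensor_lift_fun.
Proof. by move=> x y; rewrite liftD -scaleN1r liftZ scaleN1r. Qed.

Let lift_is_monoid_morphism : monoid_morphism tensor_lift_fun.
Proof.
split=> [|x y]; first by rewrite lift_pure1.
elim/tensor_ind: x => [b|a x IH|x x' IH IH'].
- elim/tensor_ind: y => [b'|a y IH|y y' IH IH'].
  + by rewrite -pureM mulr1 !lift_pure1.
  + by rewrite -scalerAr !liftZ IH scalerAr.
  + by rewrite mulrDr !liftD IH IH' mulrDr.
- by rewrite -scalerAl !liftZ IH scalerAl.
- by rewrite mulrDl !liftD IH IH' mulrDl.
Qed.

Let lift_is_scalable : scalable tensor_lift_fun.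
Proof. exact: liftZ. Qed.

Lemma tensor_lift_ex :
  {h : {lrmorphism tensor L K -> M} | forall b, h (pure 1 b) = u b}.
Proof.
pose h : {lrmorphism tensor L K -> M} := HB.pack tensor_lift_fun
  (GRing.isZmodMorphism.Build _ _ tensor_lift_fun lift_is_zmod_morphism)
  (GRing.isMonoidMorphism.Build _ _ tensor_lift_fun lift_is_monoid_morphism)
  (GRing.isScalable.Build _ _ _ _ tensor_lift_fun lift_is_scalable).
by exists h => b; apply: lift_pure1.
Qed.

Definition tensor_lift : {lrmorphism tensor L K -> M} := sval tensor_lift_ex.

Lemma tensor_liftE b : tensor_lift (pure 1 b) = u b.
Proof. exact: (svalP tensor_lift_ex). Qed.

End TensorUniversal.

Lemma tensor_lift_uniq (k : fieldType) (L : comAlgType k) (K : fieldExtType k)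
    (M : lmodType L) (f g : {linear tensor L K -> M}) :
  (forall b, f (pure 1 b) = g (pure 1 b)) -> f =1 g.
Proof.
move=> fg x; elim/tensor_ind: x => [b|a x IH|x y IHx IHy]; first exact: fg.
  by rewrite !linearZ /= IH.
by rewrite !linearD IHx IHy.
Qed.

Section AutFunctor.
Variables (k : fieldType) (K : fieldExtType k).

(* The functor of points of the group scheme: L |-> Aut_L(L (x)_k K). *)
Definition autPt (L : comAlgType k) := algAut (tensor L K).

(* f (x) 1 *)
Definition tensorf (L L' : comAlgType k) (f : {lrmorphism L -> L'})
  (z : tensor L K) : tensor L' K := map_mx f z.

Section BaseChange.
Variables (L L' : comAlgType k) (f : {lrmorphism L -> L'}).

Lemma tensorf_pure a b : tensorf f (pure a b) = pure (f a) b.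
Proof. by apply/rowP => i; rewrite !mxE linearZ. Qed.
Lemma tensorfD : {morph tensorf f : x y / x + y}.
Proof. by move=> x y; apply/rowP => i; rewrite !mxE rmorphD. Qed.
Lemma tensorfZ a x : tensorf f (a *: x) = f a *: tensorf f x.
Proof. by apply/rowP => i; rewrite !mxE rmorphM. Qed.
Lemma tensorf1 : tensorf f 1 = 1.
Proof. by rewrite [LHS]tensorf_pure rmorph1. Qed.
Lemma tensorfM : {morph tensorf f : x y / x * y}.
Proof.
move=> x y; elim/tensor_ind: x => [b|a x IH|x x' IH IH'].
- elim/tensor_ind: y => [b'|a y IH|y y' IH IH'].
  + by rewrite -pureM !tensorf_pure -pureM mulr1 rmorph1 mulr1.
  + by rewrite -scalerAr !tensorfZ IH scalerAr.
  + by rewrite mulrDr !tensorfD IH IH' mulrDr.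
- by rewrite -scalerAl !tensorfZ IH scalerAl.
- by rewrite mulrDl !tensorfD IH IH' mulrDl.
Qed.

Variable phi : {lrmorphism tensor L K -> tensor L K}.
Let u b := tensorf f (phi (pure 1 b)).
Let uD : {morph u : b b' / b + b'}.
Proof. by move=> b b'; rewrite /u pureDr rmorphD tensorfD. Qed.
Let u1 : u 1 = 1.
Proof. by rewrite /u pure11 rmorph1 tensorf1. Qed.
Let uM : {morph u : b b' / b * b'}.
Proof. by move=> b b'; rewrite /u -[1]mulr1 pureM rmorphM tensorfM mulr1. Qed.
Let uZ c b : u (c *: b) = c%:A *: u b.
Proof. by rewrite /u pureZr pure1l linearZ tensorfZ /= rmorph_alg. Qed.

Definition homMap : {lrmorphism tensor L' K -> tensor L' K} :=
  tensor_lift uD u1 uM uZ.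

Lemma homMapP x : homMap (tensorf f x) = tensorf f (phi x).
Proof.
elim/tensor_ind: x => [b|a x IH|x y IH IH'].
- by rewrite tensorf_pure rmorph1 tensor_liftE.
- rewrite tensorfZ !linearZ tensorfZ; congr (_ *: _); exact: IH.
- rewrite tensorfD !linearD tensorfD; congr (_ + _); [exact: IH|exact: IH'].
Qed.

End BaseChange.

Lemma homMapK (L L' : comAlgType k) (f : {lrmorphism L -> L'})
    (phi psi : {lrmorphism tensor L K -> tensor L K}) :
  cancel phi psi -> cancel (homMap f phi) (homMap f psi).
Proof.
move=> phiK; apply: (@tensor_lift_uniq _ _ _ _ (homMap f psi \o homMap f phi) idfun).
move=> b /=; rewrite -(rmorph1 f) -tensorf_pure.
by rewrite !homMapP phiK.
Qed.

(* The base change of phi along f, i.e. the functoriality of autPt: by autMapE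
   it is the unique L'-linear map making the square with f (x) 1 commute. *)
Definition autMap (L L' : comAlgType k) (f : {lrmorphism L -> L'})
    (phi : autPt L) : autPt L' :=
  AlgAut (homMapK f (@aut_funK _ _ phi)) (homMapK f (@aut_invK _ _ phi)).

Lemma autMapE (L L' : comAlgType k) (f : {lrmorphism L -> L'}) phi x :
  autMap f phi (tensorf f x) = tensorf f (phi x).
Proof. exact: homMapP. Qed.

Section Const.
Variables (L : comAlgType k) (g : {lrmorphism K -> K}).
Let u b : tensor L K := pure 1 (g b).
Let uD : {morph u : b b' / b + b'}.
Proof. by move=> b b'; rewrite /u rmorphD pureDr. Qed.
Let u1 : u 1 = 1.
Proof. by rewrite /u rmorph1. Qed.
Let uM : {morph u : b b' / b * b'}.
Proof. by move=> b b'; rewrite /u rmorphM -pureM mulr1. Qed.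
Let uZ c b : u (c *: b) = c%:A *: u b.
Proof. by rewrite /u linearZ pureZr pure1l. Qed.

Definition homConst : {lrmorphism tensor L K -> tensor L K} :=
  tensor_lift uD u1 uM uZ.

Lemma homConstP a b : homConst (pure a b) = pure a (g b).
Proof. by rewrite pure1l linearZ /= tensor_liftE -pure1l. Qed.

End Const.

Lemma homConstK (L : comAlgType k) (g h : {lrmorphism K -> K}) :
  cancel g h -> cancel (homConst L g) (homConst L h).
Proof.
move=> gK; apply: (@tensor_lift_uniq _ _ _ _ (homConst L h \o homConst L g) idfun).
by move=> b /=; rewrite !homConstP gK.
Qed.

(* g |-> 1 (x) g *)
Definition autConst (L : comAlgType k) (g : algAut K) : autPt L :=
  AlgAut (@homConstK L _ _ (@aut_funK _ _ g)) (@homConstK L _ _ (@aut_invK _ _ g)).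

Lemma autConstE (L : comAlgType k) (g : algAut K) a b :
  autConst L g (pure a b) = pure a (g b).
Proof. exact: homConstP. Qed.

End AutFunctor.

Section GaloisAction.
Variables (k : fieldType) (K : fieldExtType k) (L : comAlgType k).

(* sigma . phi = (sigma (x) 1) o phi o (sigma (x) 1)^-1 *)
Definition galAct (sigma : algAut L) (phi : autPt K L) (z : tensor L K) :
    tensor L K :=
  tensorf sigma (phi (tensorf (aut_inv sigma) z)).

Lemma tensorfK (sigma : algAut L) :
  cancel (@tensorf _ K _ _ (aut_inv sigma)) (tensorf sigma).
Proof. by move=> z; apply/rowP => i; rewrite !mxE aut_invK. Qed.

(* The action of sigma on points by functoriality is the one above. *)
Lemma autMap_gal (sigma : algAut L) (phi : autPt K L) :
  autMap sigma phi =1 galAct sigma phi.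
Proof. by move=> z; rewrite -[z in LHS](tensorfK sigma) autMapE. Qed.

End GaloisAction.

(* The L-points of Spec K, with the action of the L-points of autPt K. *)
Definition specPt (k : fieldType) (K : fieldExtType k) (L : comAlgType k) :=
  {lrmorphism tensor L K -> L^o}.

Definition specAct (k : fieldType) (K : fieldExtType k) (L : comAlgType k)
  (phi : autPt K L) (x : specPt K L) : specPt K L := x \o aut_inv phi.

Record subgroupFunctor (k : fieldType) (K : fieldExtType k) := SubgroupFunctor {
  subPt :> forall L : comAlgType k, set (autPt K L);
  subPt1 : forall L, @subPt L 1%g;
  subPtM : forall L (phi psi : autPt K L),
    @subPt L phi -> @subPt L psi -> @subPt L (phi * psi)%g;
  subPtV : forall L (phi : autPt K L), @subPt L phi -> @subPt L (phi^-1)%g;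
  subPt_map : forall (L L' : comAlgType k) (f : {lrmorphism L -> L'}) phi,
    @subPt L phi -> @subPt L' (autMap f phi) }.

Arguments subPt {k K} s L _.

(* A is a finite product of finite separable field extensions of k. *)
Definition finite_etale_algebra (k : fieldType) (A : comAlgType k) : Prop :=
  exists (m : nat) (F : 'I_m -> fieldExtType k)
    (p : forall i, {lrmorphism A -> F i}),
    (forall i, separable 1%VS {:F i}) /\
    (forall y : (forall i, F i), exists! a, forall i, p i a = y i).

(* H is isomorphic, as a functor of points, to Spec A. *)
Definition represents (k : fieldType) (K : fieldExtType k) (A : comAlgType k)
    (H : subgroupFunctor K) : Prop :=
  exists eta : forall L : comAlgType k, {lrmorphism A -> L} -> autPt K L,
    (forall (L L' : comAlgType k) (f : {lrmorphism L -> L'})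
       (h : {lrmorphism A -> L}), eta L' (lrcomp f h) = autMap f (eta L h)) /\
    (forall L, set_bij setT (H L) (eta L)).

Definition finite_etale (k : fieldType) (K : fieldExtType k)
    (H : subgroupFunctor K) : Prop :=
  exists A : comAlgType k, finite_etale_algebra A /\ represents A H.

Definition centralizer (gT : groupType) (A : set gT) : set gT :=
  [set x | forall y, A y -> commute x y].

(* (g, x) |-> (g x, x) on L-points *)
Definition shear (k : fieldType) (K : fieldExtType k) (H : subgroupFunctor K)
    (L : comAlgType k) (gx : {g | H L g} * specPt K L) :
    specPt K L * specPt K L :=
  (specAct (sval gx.1) gx.2, gx.2).

(* A morphism of schemes, seen as functors of points, is an isomorphism exactly
   when it is bijective on L-points for all L; every L : comAlgType k is
   nonzero, so a scheme is nonempty exactly when some L has an L-point. *)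
Definition is_torsor (k : fieldType) (K : fieldExtType k)
    (H : subgroupFunctor K) : Prop :=
  (exists L : comAlgType k, inhabited (specPt K L)) /\
  (forall L : comAlgType k, bijective (@shear k K H L)).

Record separable_closure (k F : fieldType) (iota : {rmorphism k -> F}) : Prop := {
  sepclosure_separable : forall x : F, exists2 p : {poly k},
    separable_poly p & root (map_poly iota p) x;
  sepclosure_closed : forall p : {poly F},
    separable_poly p -> (1 < size p)%N -> exists x, root p x }.

(* F as a k-algebra through iota. *)
Definition algAlong (k F : fieldType) (iota : {rmorphism k -> F}) : Type := F.

Section AlgAlong.
Variables (k F : fieldType) (iota : {rmorphism k -> F}).
Local Notation A := (algAlong iota).

HB.instance Definition _ := GRing.Field.on A.

Definition along_scale (c : k) (x : A) : A := iota c * (x : F).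

Lemma along_scaleA a b v :
  along_scale a (along_scale b v) = along_scale (a * b) v.
Proof. by rewrite /along_scale rmorphM mulrA. Qed.
Lemma along_scale1 : left_id 1 along_scale.
Proof. by move=> x; rewrite /along_scale rmorph1 mul1r. Qed.
Lemma along_scaleDr : right_distributive along_scale +%R.
Proof. by move=> c x y; rewrite /along_scale mulrDr. Qed.
Lemma along_scaleDl v : {morph along_scale^~ v : a b / a + b}.
Proof. by move=> a b; rewrite /along_scale rmorphD mulrDl. Qed.

HB.instance Definition _ := GRing.Zmodule_isLmodule.Build k A
  along_scaleA along_scale1 along_scaleDr along_scaleDl.

Lemma along_scaleAl (a : k) (x y : A) : a *: (x * y) = (a *: x) * y.
Proof. exact: mulrA. Qed.

HB.instance Definition _ := GRing.Lmodule_isLalgebra.Build k A along_scaleAl.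
HB.instance Definition _ := GRing.Lalgebra_isComAlgebra.Build k A.

End AlgAlong.

Lemma centralizer_stable (k : fieldType) (K : fieldExtType k)
    (L : comAlgType k) (sigma : algAut L) (phi : autPt K L) :
  centralizer (range (@autConst k K L)) phi ->
  centralizer (range (@autConst k K L)) (autMap sigma phi).
Proof.
move=> Cphi _ [g _ <-]; apply: algAut_inj.
apply: (@tensor_lift_uniq _ _ _ _
  (aut_fun (autMap sigma phi * autConst L g)%g)
  (aut_fun (autConst L g * autMap sigma phi)%g)) => b.
have gE z : autConst L g (tensorf sigma z) = tensorf sigma (autConst L g z).
  elim/tensor_ind: z => [c|a z IH|z z' IH IH'].
  - by rewrite autConstE !tensorf_pure autConstE.
  - rewrite tensorfZ !linearZ tensorfZ; congr (_ *: _); exact: IH.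
  - rewrite tensorfD !linearD tensorfD; congr (_ + _); [exact: IH|exact: IH'].
have sE z : (autMap sigma phi * autConst L g)%g (tensorf sigma z)
    = (autConst L g * autMap sigma phi)%g (tensorf sigma z).
  change (autMap sigma phi (autConst L g (tensorf sigma z))
          = autConst L g (autMap sigma phi (tensorf sigma z))).
  rewrite gE !autMapE gE; congr (tensorf _ _).
  have Cg := Cphi _ (ex_intro2 _ _ g I erefl).
  by have /(congr1 (fun f : autPt K L => f z)) := Cg.
by have := sE (pure 1 b); rewrite tensorf_pure rmorph1.
Qed.

(* Main.v *)
Require Import Defs.
From HB Require Import structures.
From mathcomp Require Import all_boot all_order all_algebra all_field.
From mathcomp Require Import boolp classical_sets functions.

(* Let phi in Aut_A(A (x) K) be the universal point of Gbar = Spec A.  On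
   functions the shear map is theta : K (x) K -> A (x) K,
   a (x) b |-> (1 (x) a) phi^-1(1 (x) b), and Gbar is a torsor as soon as theta
   is bijective.  A ks-point x of Spec K identifies ks (x) K with ks^G, hence
   C(G) with the centralizer of the regular permutation group G, which acts
   simply transitively on X(ks) = {x o g | g in G}.  Transitivity shows that an
   element of ker theta is killed by all maps a (x) b |-> a g(b), so that theta
   is injective.  Freeness gives #Hom(A, ks) <= n, hence dim A <= n because A is
   etale, and theta is surjective by comparing dimensions. *)

Set Implicit Arguments.
Unset Strict Implicit.
Unset Printing Implicit Defensive.

Import GRing.Theory.
Local Open Scope ring_scope.

(** * The Galois group and the matrix of conjugates of a basis *)

Section GaloisBasis.
Variables (k : fieldType) (K : splittingFieldType k).
Local Notation G := (gal_of {:K}).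
Local Notation e := (vbasis {:K}).

Definition algAut_gal (g : G) : algAut K.
Proof.
refine (@AlgAut _ _ (gal_repr g : {lrmorphism K -> K})
  (gal_repr g^-1%g : {lrmorphism K -> K}) _ _) => b /=.
  by rewrite -galM ?memvf // mulgV gal_id.
by rewrite -galM ?memvf // mulVg gal_id.
Defined.

Lemma gal_of_lrmorphism (f : {lrmorphism K -> K}) : exists g : G, f =1 g.
Proof.
have: kHom 1 {:K} (linfun f).
  by apply/kHom_lrmorphism; split=> [x y|]; rewrite !lfunE /= ?rmorphM ?rmorph1.
rewrite -kAutfE => /kAut_to_gal[g _ fg].
by exists g => b; rewrite -fg ?memvf // lfunE.
Qed.

Hypothesis galK : galois 1%VS {:K}.

Lemma card_gal_of : #|{: G}| = \dim {:K}.
Proof.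
have := galois_dim galK; rewrite dimv1 divn1 => ->.
apply/esym/eq_card => g; rewrite gal_kHom ?sub1v // inE; exact: k1AHom.
Qed.

(** The matrix M of the g(e_i) is square since G has order [K : k], and invertible by independence
    of characters. [B] is its inverse: the two identities are M B = 1 and B M = 1. *)
Lemma gal_dual_basis : exists B : 'I_(\dim {:K}) -> G -> K,
  (forall g h : G, \sum_(i < \dim {:K}) g e`_i * B i h = (g == h)%:R) /\
  (forall i j : 'I_(\dim {:K}), \sum_(g : G) B i g * g e`_j = (i == j)%:R).
Proof.
pose M : 'M[K]_(#|{: G}|, \dim {:K}) := \matrix_(a, i) (enum_val a : G) e`_i.
have fM : row_free M.
  apply/inj_row_free => v vM; apply/rowP => a; rewrite mxE.
  rewrite -[a]enum_valK; move: (enum_val a) => g; rewrite [LHS]/=.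
  apply: (gal_independent (P := predT) (c_ := fun g => v 0 (enum_rank g))) => // b _.
  rewrite (coord_vbasis (memvf b)).
  under eq_bigr do rewrite linear_sum mulr_sumr.
  rewrite exchange_big big1 // => i _.
  under eq_bigr do rewrite linearZ /= -scalerAr.
  rewrite (reindex (fun a : 'I_#|{: G}| => enum_val a : G)) /=; last first.
    by exists enum_rank => x _; rewrite ?enum_valK ?enum_rankK.
  rewrite -scaler_sumr; apply/eqP; rewrite scaler_eq0; apply/orP; right; apply/eqP.
  have /rowP/(_ i) := vM; rewrite !mxE => vMi; rewrite -[RHS]vMi.
  by apply: eq_bigr => c _; rewrite !mxE enum_valK.
have [B MB] := row_freeP fM.
(* M is square only up to [card_gal_of], so full rank first provides some left inverse [B'], which
   then equals [B]. *)
have BM : B *m M = 1%:M.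
  have [B' B'M] : exists B', B' *m M = 1%:M.
    by apply/row_fullP; rewrite /row_full (eqnP fM) card_gal_of.
  by rewrite -[B]mul1mx -B'M -(mulmxA B') MB mulmx1.
exists (fun i g => B i (enum_rank g)); split=> [g h|i j].
  have /matrixP/(_ (enum_rank g) (enum_rank h)) := MB; rewrite !mxE.
  rewrite (inj_eq enum_rank_inj) => <-.
  by apply: eq_bigr => i _; rewrite mxE enum_rankK.
have /matrixP/(_ i j) := BM; rewrite !mxE => <-.
rewrite (reindex (fun a : 'I_#|{: G}| => enum_val a : G)) /=; last first.
  by exists enum_rank => x _; rewrite ?enum_valK ?enum_rankK.
by apply: eq_bigr => a _; rewrite mxE enum_valK.
Qed.
End GaloisBasis.

(** * Points of Spec K over L as k-algebra maps from K to L *)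

Section RationalPoints.
Variables (k : fieldType) (K : fieldExtType k) (L : comAlgType k).

Lemma pureNr (a : L) (b : K) : pure a (- b) = - pure a b.
Proof. by apply/rowP => i; rewrite !mxE linearN scaleNr. Qed.

Section Extend.
Variable u : {lrmorphism K -> L}.
Let uZ c b : (u : K -> L^o) (c *: b) = c%:A *: (u b : L^o).
Proof. by rewrite linearZ; exact: (esym (mulr_algl c (u b : L))). Qed.

Definition specPt_of : specPt K L :=
  @tensor_lift k L K L^o u (rmorphD u) (rmorph1 u) (rmorphM u) uZ.

Lemma specPt_ofE a b : specPt_of (pure a b) = a * u b.
Proof. by rewrite pure1l linearZ /= tensor_liftE. Qed.
End Extend.

Lemma specPt_pure (x : specPt K L) a b : x (pure a b) = a * x (pure 1 b).
Proof. by rewrite pure1l linearZ. Qed.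

Lemma specPt_ext (x y : specPt K L) :
  (forall b, x (pure 1 b) = y (pure 1 b)) -> x = y.
Proof. by move=> xy; apply/lrmorphism_inj/tensor_lift_uniq. Qed.

Section Restrict.
Variable x : specPt K L.
Definition res_fun (b : K) : L := x (pure 1 b).
Let res_zmod : zmod_morphism res_fun.
Proof.
by move=> b c; rewrite /res_fun pureDr pureNr linearB.
Qed.
Let res_monoid : monoid_morphism res_fun.
Proof.
split; first exact: (rmorph1 x).
by move=> b c; rewrite /res_fun pure1M; apply: (rmorphM x).
Qed.
Let res_scal : scalable res_fun.
Proof. by move=> c b; rewrite /res_fun pureZr specPt_pure mulr_algl. Qed.

Definition specPt_res : {lrmorphism K -> L} := HB.pack res_fun
  (GRing.isZmodMorphism.Build _ _ res_fun res_zmod)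
  (GRing.isMonoidMorphism.Build _ _ res_fun res_monoid)
  (GRing.isScalable.Build _ _ _ _ res_fun res_scal).
End Restrict.

Lemma specActE (phi : autPt K L) (x : specPt K L) z :
  specAct phi x z = x (aut_inv phi z).
Proof. by []. Qed.

End RationalPoints.

(** * The algebra L (x) K as L^G, and the centralizer of G *)

Section GaloisCoordinates.
Variables (k : fieldType) (K : splittingFieldType k).
Hypothesis galK : galois 1%VS {:K}.
Variable L : comAlgType k.
Local Notation G := (gal_of {:K}).
Local Notation e := (vbasis {:K}).
Implicit Types (x y : specPt K L) (g h t : G) (z w : tensor L K).
Local Notation galConst g := (autConst L (algAut_gal g)).

(* The isomorphism L (x) K = L^G given by an L-point of Spec K. *)
Definition galCoord x z : G -> L := fun g => x (galConst g z).

Lemma galCoordE x z g :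
  galCoord x z g = \sum_(i < \dim {:K}) z 0 i * x (pure 1 (g e`_i)).
Proof.
rewrite /galCoord [z in LHS]tensor_sum !linear_sum; apply: eq_bigr => i _ /=.
by rewrite !linearZ /=; congr (_ * x _); exact: (autConstE (algAut_gal g)).
Qed.

(** In the basis 1 (x) e_i, [galCoord x] is the image of the matrix of the g(e_i) under the ring map
    b |-> x(1 (x) b), so the image of its inverse [B] inverts it over any L. *)
Lemma galCoord_bij x : bijective (galCoord x).
Proof.
have [B [BD1 BD2]] := gal_dual_basis galK.
have res_sum I r (F : I -> K) :
    x (pure 1 (\sum_(i <- r) F i)) = \sum_(i <- r) x (pure 1 (F i)).
  exact: (linear_sum (specPt_res x)).
have resM b c : x (pure 1 (b * c)) = x (pure 1 b) * x (pure 1 c).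
  exact: (rmorphM (specPt_res x)).
have res_nat b : x (pure 1 (b%:R)) = b%:R.
  exact: (rmorph_nat (specPt_res x)).
exists (fun v => \row_i \sum_g v g * x (pure 1 (B i g))) => [z|v].
  apply/rowP => j; rewrite !mxE.
  under eq_bigr do rewrite galCoordE mulr_suml.
  rewrite exchange_big (bigD1 j) //= [X in _ + X]big1 => [|i ij].
    under eq_bigr do rewrite -mulrA -resM.
    rewrite -mulr_sumr -res_sum.
    under eq_bigr do rewrite mulrC.
    by rewrite BD2 eqxx res_nat mulr1 addr0.
  under eq_bigr do rewrite -mulrA -resM.
  rewrite -mulr_sumr -res_sum.
  under eq_bigr do rewrite mulrC.
  by rewrite BD2 eq_sym (negPf ij) res_nat mulr0.
apply/funext => h; rewrite galCoordE.
under eq_bigr do rewrite mxE mulr_suml.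
rewrite exchange_big (bigD1 h) //= [X in _ + X]big1 => [|g gh].
  under eq_bigr do rewrite -mulrA -resM.
  rewrite -mulr_sumr -res_sum.
  under eq_bigr do rewrite mulrC.
  by rewrite BD1 eqxx res_nat mulr1 addr0.
under eq_bigr do rewrite -mulrA -resM.
rewrite -mulr_sumr -res_sum.
under eq_bigr do rewrite mulrC.
by rewrite BD1 eq_sym (negPf gh) res_nat mulr0.
Qed.

(** Products in [gal_of] apply the left factor first, (t * g)(b) = g(t(b)), which is why G
    translates the index of [galCoord] on the left. *)
Lemma galConst_comp (f : algAut K) g t :
  (forall b, f b = t b) -> forall z,
  galConst g (autConst L f z) = galConst (t * g)%g z.
Proof.
move=> ft; apply: (@tensor_lift_uniq _ _ _ _
  (aut_fun (galConst g) \o aut_fun (autConst L f)) (aut_fun (galConst (t * g)%g))).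
move=> b /=; rewrite !(autConstE f, autConstE (algAut_gal _)) /=.
by rewrite galM ?memvf // ft.
Qed.

Lemma galConst1 z : galConst 1%g z = z.
Proof.
apply: (@tensor_lift_uniq _ _ _ _ (aut_fun (galConst 1%g)) idfun) => b /=.
by rewrite (autConstE (algAut_gal _)) /= gal_id.
Qed.

(** If phi commutes with G, coordinate g of phi^-1(z) is x(phi^-1(g z)), the value of the point
    phi.x at g z; so phi.x determines phi. *)
Lemma centralizer_free x phi psi :
  centralizer (range (@autConst k K L)) phi ->
  centralizer (range (@autConst k K L)) psi ->
  specAct phi x = specAct psi x -> phi = psi.
Proof.
have invC f g z : centralizer (range (@autConst k K L)) f ->
    galConst g (aut_inv f z) = aut_inv f (galConst g z).
  move=> /(_ _ (ex_intro2 _ _ (algAut_gal g) I erefl)) fC.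
  apply: (can_inj (@aut_funK _ _ f)); rewrite aut_invK.
  have /(congr1 (fun h : autPt K L => h (aut_inv f z))) := fC.
  by rewrite /= aut_invK.
(* [specAct] composes with [aut_inv], so it is the inverses that are compared. *)
move=> Cphi Cpsi xE; suff e : aut_V phi = aut_V psi.
  by move/(congr1 (@aut_V _ _)): e; case: (phi) (psi) => ? ? ? ? [].
apply: algAut_inj => z /=; apply: (bij_inj (galCoord_bij x)).
apply/funext => g; rewrite /galCoord !invC // -!specActE.
by rewrite xE.
Qed.

(** When L is a field, [rmorphism_gal] shows that the points x o t reached here are all of X(L). *)
Lemma centralizer_transitive x t : exists2 phi,
  centralizer (range (@autConst k K L)) phi &
  forall b, specAct phi x (pure 1 b) = x (pure 1 (t b)).
Proof.
have [Q PQ QP] := galCoord_bij x.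
(* In the coordinates of galCoord, G acts by left translations of the index;
   the right translations psi s commute with it. *)
pose psi s z := Q (fun g => galCoord x z (g * s)%g).
have psiE s z g : galCoord x (psi s z) g = galCoord x z (g * s)%g.
  by rewrite /psi QP.
have PP z w : galCoord x z =1 galCoord x w -> z = w.
  by move/funext/(can_inj PQ).
have psiB s : zmod_morphism (psi s).
  move=> z w; apply: PP => g; rewrite psiE /galCoord !linearB /=.
  by rewrite -!/(galCoord x _ _) !psiE.
have psiM s : monoid_morphism (psi s).
  split=> [|z w]; apply: PP => g; rewrite psiE /galCoord.
    by rewrite !rmorph1.
  by rewrite !rmorphM /= -!/(galCoord x _ _) !psiE.
have psiZ s : scalable (psi s).
  move=> a z; apply: PP => g; rewrite psiE /galCoord !linearZ /=.
  by rewrite -!/(galCoord x _ _) !psiE.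
pose psil s : {lrmorphism tensor L K -> tensor L K} := HB.pack (psi s)
  (GRing.isZmodMorphism.Build _ _ (psi s) (psiB s))
  (GRing.isMonoidMorphism.Build _ _ (psi s) (psiM s))
  (GRing.isScalable.Build _ _ _ _ (psi s) (psiZ s)).
have psiK s : cancel (psil s^-1%g) (psil s).
  by move=> z; apply: PP => g; rewrite /= !psiE mulgK.
have psiK' s : cancel (psil s) (psil s^-1%g).
  by move=> z; apply: PP => g; rewrite /= !psiE mulgVK.
(* This automorphism is [psi t^-1] with inverse [psi t], so its action evaluates x at
   [psi t (pure 1 b)]. That is coordinate 1 of the translate, hence coordinate t of [pure 1 b]. *)
exists (AlgAut (psiK t) (psiK' t)); last first.
  move=> b; rewrite specActE /=.
  have := psiE t (pure 1 b) 1%g; rewrite /galCoord mul1g.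
  rewrite (autConstE (algAut_gal t)) => <-.
  by rewrite galConst1.
move=> _ [f _ <-]; apply: algAut_inj => z.
have [s fs] := gal_of_lrmorphism f.
apply: PP => g.
rewrite /galCoord; change (galCoord x (psi t^-1%g (autConst L f z)) g =
  x (galConst g (autConst L f (psi t^-1%g z)))).
(* Left and right translations commute by associativity in G. *)
rewrite psiE /galCoord !(galConst_comp _ fs) mulgA.
by rewrite -[RHS]/(galCoord x (psi t^-1%g z) (s * g)%g) psiE.
Qed.

End GaloisCoordinates.

(** * Embeddings into a field, and a dimension bound for étale algebras *)

Lemma rmorphism_gal (k : fieldType) (K : splittingFieldType k) (F : fieldType)
    (u v : {rmorphism K -> F}) :
    galois 1%VS {:K} -> (forall c : k, u c%:A = v c%:A) ->
  exists t : gal_of {:K}, forall b, v b = u (t b).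
Proof.
move=> galK uv; have [B [BD1 BD2]] := gal_dual_basis galK.
pose e := vbasis {:K}.
(* E t is the component at t of the image of the idempotents of
   K (x) K = K^G under u (x) v; exactly one of them is nonzero in F. *)
pose E t := \sum_(i < \dim {:K}) u (B i t) * v e`_i.
have vE b : v b = \sum_t E t * u (t b).
  have vEe (j : 'I_(\dim {:K})) : v e`_j = \sum_t E t * u (t e`_j).
    under eq_bigr do rewrite mulr_suml.
    rewrite exchange_big (bigD1 j) //= [X in _ + X]big1 => [|i ij].
      under eq_bigr do rewrite mulrAC -rmorphM.
      by rewrite -mulr_suml -rmorph_sum BD2 eqxx rmorph1 mul1r addr0.
    under eq_bigr do rewrite mulrAC -rmorphM.
    by rewrite -mulr_suml -rmorph_sum BD2 (negPf ij) rmorph0 mul0r.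
  rewrite (coord_vbasis (memvf b)) rmorph_sum.
  under [RHS]eq_bigr do rewrite linear_sum rmorph_sum mulr_sumr.
  rewrite exchange_big; apply: eq_bigr => i _ /=.
  rewrite -mulr_algl rmorphM vEe mulr_sumr; apply: eq_bigr => t _.
  by rewrite mulr_algl linearZ /= -(mulr_algl _ (t _)) [in RHS]rmorphM uv mulrCA.
(* Expanding v(bc) by [vE], directly and as v(b) v(c), gives a linear relation between the maps u o
   s; pairing it with [B] isolates the coefficient of t. *)
have Emul t c : E t * u (t c) = E t * v c.
  have indep b : \sum_s (E s * u (s c) - E s * v c) * u (s b) = 0.
    under eq_bigr do rewrite mulrBl.
    rewrite sumrB; under eq_bigr do rewrite -mulrA [u _ * u _]mulrC -!rmorphM.
    rewrite -vE rmorphM [X in _ - X](_ : _ = v b * v c) ?subrr // (vE b) mulr_suml.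
    by apply: eq_bigr => s _; rewrite mulrAC.
  apply/eqP; rewrite -subr_eq0; apply/eqP; set d := LHS.
  have: \sum_(i < \dim {:K})
      \sum_s (E s * u (s c) - E s * v c) * u (s e`_i) * u (B i t) = 0.
    by rewrite big1 // => i _; rewrite -mulr_suml indep mul0r.
  rewrite exchange_big (bigD1 t) //= [X in _ + X]big1 => [|s st].
    under eq_bigr do rewrite -mulrA -rmorphM.
    by rewrite -mulr_sumr -rmorph_sum BD1 eqxx rmorph1 mulr1 addr0.
  under eq_bigr do rewrite -mulrA -rmorphM.
  by rewrite -mulr_sumr -rmorph_sum BD1 (negPf st) rmorph0 mulr0.
(* Otherwise [vE] would give v(1) = 0. *)
have [t Et0] : exists t, E t != 0.
  apply: contrapT => /forallNP E0.
  have := rmorph1 v; rewrite vE big1 => [/esym/eqP|t _]; first by rewrite oner_eq0.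
  by have /negP/negbNE/eqP -> := E0 t; rewrite mul0r.
by exists t => b; apply: (mulfI Et0); rewrite Emul.
Qed.

Section Embeddings.
Variables (k ks : fieldType) (iota : {rmorphism k -> ks}).

(** Linear factors are split off one at a time. Separability of p makes the cofactor separable and
    coprime to the factor, so no root recurs. *)
Lemma separable_poly_roots (p : {poly ks}) :
    separable_closure iota -> separable_poly p ->
  exists s : seq ks, [/\ uniq s, size s = (size p).-1 & all (root p) s].
Proof.
move=> ksP; have [n] := ubnP (size p); elim: n p => // n IHn p lepn sep_p.
have [p_le1|p_gt1] := leqP (size p) 1.
  by exists [::]; split=> //; case: (size p) p_le1 => [|[]].
have [x px] := sepclosure_closed ksP sep_p p_gt1.
have [q pE] := factor_theorem _ _ px.
move: (sep_p); rewrite pE separable_mul => /and3P[sep_q _ co_q].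
have q0 : q != 0 by apply: contraTneq p_gt1 => q0; rewrite pE q0 mul0r size_poly0.
have szp : size p = (size q).+1.
  by rewrite pE size_Mmonic ?monicXsubC ?q0 // size_XsubC addn2.
have [||s [us ss rs]] := IHn q; rewrite ?sep_q // -?szp //.
exists (x :: s); split=> /=.
- rewrite us andbT; apply/negP => /(allP rs) qx.
  by move: co_q; rewrite coprimep_XsubC qx.
- by rewrite -pE szp ss /= prednK // lt0n size_poly_eq0.
- rewrite -pE px; apply/allP => y /(allP rs) qy.
  by rewrite pE rootM [root q y]qy.
Qed.

(** F is k[X]/(q), and the map is evaluation at r. Each y goes to the value at r of a chosen
    polynomial [P y] with value y at a; by [PE'] any other representative gives the same value,
    because the minimal polynomial q vanishes at r. *)
Lemma embed_root (F : fieldExtType k) (a : F) (q : {poly k}) (r : ks) :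
    <<1; a>>%VS = {:F}%VS -> minPoly 1 a = map_poly (in_alg F) q ->
    root (map_poly iota q) r ->
  exists f : {lrmorphism F -> algAlong iota}, f a = r.
Proof.
move=> Fa qE qr.
have kerP (p : {poly k}) :
    (map_poly (in_alg F) p).[a] = 0 -> (map_poly iota p).[r] = 0.
  move=> pa; apply/rootP; apply: root_dvdp qr; rewrite dvdp_map.
  rewrite -(dvdp_map (in_alg F)) -qE minPoly_dvdp //; last exact/rootP.
  by apply/polyOver1P; exists p.
have /choice[P PE] y : exists p, (map_poly (in_alg F) p).[a] = y.
  have : y \in <<1; a>>%VS by rewrite Fa memvf.
  by case/Fadjoin_polyP => p /polyOver1P[p' ->] ->; exists p'.
have PE' (p : {poly k}) y :
    (map_poly (in_alg F) p).[a] = y ->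
    (map_poly iota (P y)).[r] = (map_poly iota p).[r].
  move=> pa; apply/eqP; rewrite -subr_eq0 -hornerN -hornerD -rmorphB; apply/eqP.
  by apply: kerP; rewrite rmorphB hornerD hornerN PE pa subrr.
pose f (y : F) : algAlong iota := (map_poly iota (P y)).[r].
have fB : zmod_morphism f.
  move=> y z; rewrite /f (PE' (P y - P z)) ?rmorphB ?hornerD ?hornerN ?PE //.
have fM : monoid_morphism f.
  split=> [|y z]; first by rewrite /f (PE' 1) ?rmorph1 ?hornerC.
  by rewrite /f (PE' (P y * P z)) ?rmorphM ?hornerM ?PE.
have fZ : scalable f.
  move=> c y; rewrite /f (PE' (c%:P * P y)) ?rmorphM ?hornerM /= map_polyC hornerC //=.
  by rewrite PE mulr_algl.
pose fl : {lrmorphism F -> algAlong iota} := HB.pack f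
  (GRing.isZmodMorphism.Build _ _ f fB)
  (GRing.isMonoidMorphism.Build _ _ f fM)
  (GRing.isScalable.Build _ _ _ _ f fZ).
by exists fl; rewrite /= /f (PE' 'X) ?map_polyX ?hornerX.
Qed.

(** By the primitive element theorem F = k(a), and the separable minimal polynomial of a has [F : k]
    distinct roots in ks, each a possible image of a. *)
Lemma separable_embeddings (F : fieldExtType k) :
    separable_closure iota -> separable 1%VS {:F} ->
  exists f : 'I_(\dim {:F}) -> {lrmorphism F -> algAlong iota}, injective f.
Proof.
move=> ksP sepF.
have Fa := eq_adjoin_separable_generator sepF (sub1v _).
set a := separable_generator _ _ in Fa.
have sep_a : separable_element 1 a by exact: separable_generatorP.
have [q qE] := polyOver1P (minPolyOver 1 a).
have sep_q : separable_poly (map_poly iota q).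
  by rewrite separable_map; move: sep_a; rewrite /separable_element qE separable_map.
have [s [us ss rs]] := separable_poly_roots ksP sep_q.
have szs : size s = \dim {:F}.
  by rewrite ss size_map_poly -(size_map_poly (in_alg F)) -qE size_minPoly /=
    Fa dim_Fadjoin dimv1 muln1.
have /choice[f fE] (i : 'I_(\dim {:F})) :
    exists f : {lrmorphism F -> algAlong iota}, f a = s`_i.
  apply: (embed_root (esym Fa) qE); apply: (allP rs); rewrite mem_nth //.
  by rewrite szs.
exists f => i j fij; apply/val_inj/eqP.
have szi (l : 'I_(\dim {:F})) : (l < size s)%N by rewrite szs.
rewrite -(nth_uniq (0 : ks) (szi i) (szi j) us); apply/eqP.
by rewrite -[LHS]fE -[RHS]fE fij.
Qed.
End Embeddings.

(** The projections to the factors F_i followed by embeddings of F_i into ks are as many distinct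
    maps as the sum of the [F_i : k], so [c] bounds this sum by #|T|. Bases of the factors, extended
    by zero, span A. *)
Lemma etale_spanning (k ks : fieldType) (iota : {rmorphism k -> ks})
    (A : comAlgType k) (T : finType) (c : {lrmorphism A -> algAlong iota} -> T) :
    separable_closure iota -> finite_etale_algebra A -> injective c ->
  exists d (a : 'I_d -> A), (d <= #|T|)%N /\
    forall y, exists b : 'I_d -> k, y = \sum_(l < d) b l *: a l.
Proof.
move=> ksP [m [F [p [sepF p_bij]]]] c_inj.
have p_inj y z : (forall i, p i y = p i z) -> y = z.
  move=> yz; have [w [_ w_uniq]] := p_bij (fun i => p i y).
  by rewrite -(w_uniq y) // -(w_uniq z).
have /choice[inj_ injE] (iz : {i : 'I_m & F i}) : exists a,
    p (tag iz) a = tagged iz /\ forall i, i != tag iz -> p i a = 0.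
  case: iz => i z; have [a [aE _]] := p_bij (dfwith (fun i => 0 : F i) z).
  exists a => /=; split=> [|j ji]; first by rewrite aE dfwith_in.
  by rewrite aE dfwith_out // eq_sym.
have f_ex i := cid (separable_embeddings ksP (sepF i)).
pose f i := sval (f_ex i); have f_inj i : injective (f i) := svalP (f_ex i).
pose I : finType := {i : 'I_m & 'I_(\dim {:F i})}.
pose a0 (s : I) := inj_ (Tagged F (vbasis {:F (tag s)})`_(tagged s)).
pose hom (s : I) : {lrmorphism A -> algAlong iota} :=
  lrcomp (f (tag s) (tagged s)) (p (tag s)).
have hom_inj : injective hom.
  move=> [i j] [i' j'] /= e.
  have homE b : f i j (p i b) = f i' j' (p i' b).
    exact: (congr1 (fun h : {lrmorphism A -> algAlong iota} => h b) e).
  (* Maps through different factors differ on the idempotent of factor i: one sends it to 1, the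
     other to 0. *)
  have [ii'|/eqP ii'] := pselect (i' = i); last first.
    have [/= p1 p0] := injE (Tagged F (1 : F i)).
    have := homE (inj_ (Tagged F (1 : F i))); rewrite p1 p0 // rmorph1 rmorph0.
    by move/eqP; rewrite oner_eq0.
  subst i'; clear e; move: homE => homE; congr existT.
  apply: f_inj; apply: lrmorphism_inj => z.
  by have [/= <- _] := injE (Tagged F z).
have card_I : (#|I| <= #|T|)%N := leq_card _ (inj_comp c_inj hom_inj).
exists #|I|, (fun l => a0 (enum_val l)); split=> // y.
pose b0 (s : I) := coord (vbasis {:F (tag s)}) (tagged s) (p (tag s) y).
exists (fun l => b0 (enum_val l)); apply: p_inj => i.
rewrite -(big_enum_val (A := I) (fun s => b0 s *: a0 s)) /=.
rewrite -(sig_big_dep (I := 'I_m) (J := fun i => 'I_(\dim {:F i}))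
  xpredT (fun _ => xpredT)
  (fun i j => b0 (existT _ i j) *: a0 (existT _ i j))) /=.
rewrite linear_sum (bigD1 i) //= [X in _ + X]big1 => [|i' ii']; last first.
  rewrite linear_sum big1 // => j _; rewrite linearZ /=.
  have [_ ->] := injE (Tagged F (vbasis {:F i'})`_j); first by rewrite scaler0.
  by rewrite eq_sym.
rewrite addr0 linear_sum [LHS](coord_vbasis (memvf _)).
apply: eq_bigr => j _; rewrite linearZ /=; congr (_ *: _).
by have [] := injE (Tagged F (vbasis {:F i})`_j).
Qed.

(* S as an R-algebra through f. *)
Definition algVia (R S : comNzRingType) (f : {rmorphism R -> S}) : Type := S.

Section AlgVia.
Variables (R S : comNzRingType) (f : {rmorphism R -> S}).
Local Notation A := (algVia f).

HB.instance Definition _ := GRing.ComNzRing.on A.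

Definition via_scale (c : R) (s : A) : A := f c * (s : S).

Lemma via_scaleA a b v : via_scale a (via_scale b v) = via_scale (a * b) v.
Proof. by rewrite /via_scale rmorphM mulrA. Qed.
Lemma via_scale1 : left_id 1 via_scale.
Proof. by move=> s; rewrite /via_scale rmorph1 mul1r. Qed.
Lemma via_scaleDr : right_distributive via_scale +%R.
Proof. by move=> c s t; rewrite /via_scale mulrDr. Qed.
Lemma via_scaleDl v : {morph via_scale^~ v : a b / a + b}.
Proof. by move=> a b; rewrite /via_scale rmorphD mulrDl. Qed.

HB.instance Definition _ := GRing.Zmodule_isLmodule.Build R A
  via_scaleA via_scale1 via_scaleDr via_scaleDl.

Lemma via_scaleAl (a : R) (s t : A) : a *: (s * t) = (a *: s) * t.
Proof. exact: mulrA. Qed.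

HB.instance Definition _ := GRing.Lmodule_isLalgebra.Build R A via_scaleAl.
HB.instance Definition _ := GRing.Lalgebra_isComAlgebra.Build R A.

Lemma via_scaleE (c : R) (s : A) : c *: s = f c * (s : S).
Proof. by []. Qed.

End AlgVia.

(** * The shear map on functions, and a torsor criterion *)

Section PureRight.
Variables (k : fieldType) (K : fieldExtType k) (L : comAlgType k).

(** Named to carry a ring morphism structure, so that [algVia pure_right] is L (x) K as a K-algebra
    through its second factor. *)
Definition pure_right (b : K) : tensor L K := pure 1 b.
Let pure_rightB : zmod_morphism pure_right.
Proof. by move=> b c; rewrite /pure_right pureDr pureNr. Qed.
Let pure_rightM : monoid_morphism pure_right.
Proof. by split=> // b c; apply: pure1M. Qed.
HB.instance Definition _ :=
  GRing.isZmodMorphism.Build _ _ pure_right pure_rightB.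
HB.instance Definition _ :=
  GRing.isMonoidMorphism.Build _ _ pure_right pure_rightM.

Section Mult.
Variables x y : specPt K L.
Local Notation M := (algVia (specPt_res x)).
Let v (b : K) : M := specPt_res y b.
Let vZ c b : v (c *: b) = c%:A *: v b.
Proof.
transitivity ((c%:A : L) * specPt_res y b).
  by rewrite mulr_algl /v linearZ.
by congr (_ * _); apply/esym/(rmorph_alg (specPt_res x)).
Qed.

(* a (x) b |-> x(a) y(b) *)
Definition specPt_pair : {lrmorphism tensor K K -> M} :=
  @tensor_lift k K K M v (rmorphD (specPt_res y)) (rmorph1 (specPt_res y))
    (rmorphM (specPt_res y)) vZ.

Lemma specPt_pairE b : specPt_pair (pure 1 b) = y (pure 1 b) :> L.
Proof. by rewrite [LHS]tensor_liftE. Qed.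
Lemma specPt_pairZ a z :
  specPt_pair (a *: z) = x (pure 1 a) * (specPt_pair z : L) :> L.
Proof. by rewrite linearZ. Qed.
End Mult.

Section Theta.
Variable phi : autPt K L.
Local Notation M := (algVia pure_right).
Let v (b : K) : M := aut_inv phi (pure_right b).
Let vZ c b : v (c *: b) = c%:A *: v b.
Proof.
rewrite /v /pure_right pureZr pure1l linearZ via_scaleE /=.
by rewrite /pure_right pureZr [pure c%:A 1]pure1l -[RHS]scalerAl mul1r.
Qed.

(* a (x) b |-> (1 (x) a) phi^-1(1 (x) b), the comorphism of the shear map *)
Definition coshear : {lrmorphism tensor K K -> M} :=
  @tensor_lift k K K M v
    (rmorphD (aut_inv phi \o pure_right)) (rmorph1 (aut_inv phi \o pure_right))
    (rmorphM (aut_inv phi \o pure_right)) vZ.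

Lemma coshearE b : coshear (pure 1 b) = aut_inv phi (pure 1 b) :> tensor L K.
Proof. by rewrite [LHS]tensor_liftE. Qed.
Lemma coshearZ a z :
  coshear (a *: z) = pure 1 a * (coshear z : tensor L K) :> tensor L K.
Proof. by rewrite linearZ. Qed.
End Theta.
End PureRight.

(** With g = [autMap h phi], evaluating [coshear] of a function at (g, x) evaluates the function at
    (x, g.x). On 1 (x) b this is base change of phi^-1 along h, and both sides are K-linear through
    the left factor. *)
Lemma coshear_eval (k : fieldType) (K : fieldExtType k) (A L : comAlgType k)
    (phi : autPt K A) (h : {lrmorphism A -> L}) (x : specPt K L) z :
  x (tensorf h (coshear phi z)) = specPt_pair x (specAct (autMap h phi) x) z.
Proof.
elim/tensor_ind: z => [b|a z IH|z z' IH IH'].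
- rewrite coshearE specPt_pairE specActE; congr (x _).
  have <- : tensorf h (pure 1 b) = pure 1 b :> tensor L K.
    by rewrite tensorf_pure rmorph1.
  exact: (esym (homMapP h (aut_inv phi) (pure 1 b))).
- rewrite coshearZ specPt_pairZ tensorfM tensorf_pure rmorph1 -IH.
  exact: (rmorphM x).
- rewrite !(linearD (specPt_pair _ _)) /= -IH -IH' -linearD -tensorfD.
  by rewrite (linearD (coshear phi)).
Qed.

(** [coshear] is K-linear from a space of dimension [K : k] to one spanned by the d elements a_l (x)
    1. *)
Lemma coshear_surj (k : fieldType) (K : fieldExtType k) (A : comAlgType k)
    (phi : autPt K A) d (a : 'I_d -> A) :
    (d <= \dim {:K})%N ->
    (forall y, exists b : 'I_d -> k, y = \sum_(l < d) b l *: a l) ->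
    injective (coshear phi) ->
  forall w : tensor A K, exists z, coshear phi z = w :> tensor A K.
Proof.
move=> led spanA inj_cs.
pose S (c : 'rV[K]_d) : tensor A K := \sum_(l < d) pure (a l) (c 0 l).
have S_surj w : exists c, w = S c.
  have /choice[b bE] (i : 'I_(\dim {:K})) := spanA (w 0 i).
  exists (\row_l \sum_(i < \dim {:K}) b i l *: (vbasis {:K})`_i).
  rewrite [LHS]tensor_sum; under eq_bigr do rewrite -pure1l bE pure_suml.
  rewrite exchange_big; apply: eq_bigr => l _; rewrite mxE pure_sumr.
  by apply: eq_bigr => i _; rewrite pureZr.
(* Lifting the images of the basis vectors along [S] gives a matrix M through which [coshear]
   factors; injectivity makes M row free, and d <= [K : k] makes it invertible. *)
have /choice[m mE] (i : 'I_(\dim {:K})) :=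
  S_surj (coshear phi (pure 1 (vbasis {:K})`_i)).
pose M := \matrix_i m i.
have csE (z : 'rV[K]_(\dim {:K})) : coshear phi (z : tensor K K) = S (z *m M).
  rewrite [z in LHS]tensor_sum linear_sum.
  transitivity (\sum_i pure 1 (z 0 i) * S (m i) : tensor A K).
    by apply: eq_bigr => i _; rewrite -mE; apply: coshearZ.
  rewrite /S; under eq_bigr do rewrite mulr_sumr.
  rewrite exchange_big; apply: eq_bigr => l _; rewrite mxE pure_sumr.
  by apply: eq_bigr => i _; rewrite mxE -pureM mul1r.
have M_free : row_free M.
  apply/inj_row_free => v vM; apply: (inj_cs (v : tensor K K) 0).
  rewrite [LHS](csE v) vM rmorph0 /S big1 // => l _.
  by apply/rowP => j; rewrite !mxE linear0 scale0r.
have /row_fullP[N NM] : row_full M.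
  rewrite /row_full (eqnP M_free) eqn_leq led andbT.
  by rewrite -(eqnP M_free) rank_leq_col.
move=> w; have [c ->] := S_surj w.
by exists (c *m N); rewrite csE -mulmxA NM mulmx1.
Qed.

(** Pairs (h, x) are the ring maps A (x) K -> L over k and pairs of points those on K (x) K, so the
    inverse of [coshear] inverts the shear map on L-points. *)
Lemma torsor_of_coshear (k : fieldType) (K : fieldExtType k) (A : comAlgType k)
    (H : subgroupFunctor K) (phi : autPt K A) :
    (forall L, set_bij setT (H L)
       (fun h : {lrmorphism A -> L} => autMap h phi)) ->
    injective (coshear phi) ->
    (forall w : tensor A K, exists z, coshear phi z = w :> tensor A K) ->
  is_torsor H.
Proof.
move=> H_bij inj_cs surj_cs; split.
  by exists K; split; exact: (specPt_of (idfun : {lrmorphism K -> K})).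
move=> L; have [H_fun H_inj H_surj] := H_bij L.
rewrite -setTT_bijective; split=> //.
  move=> [[g Hg] x] [[g' Hg'] x'] _ _ E.
  have xx' : x = x' := congr1 snd E.
  have gx : specAct g x = specAct g' x by rewrite [in RHS]xx'; apply: (congr1 fst E).
  rewrite -{}xx' {E}; congr pair; apply: eq_exist; rewrite /=.
  have [h _ hg] := H_surj _ Hg; have [h' _ hg'] := H_surj _ Hg'.
  rewrite -hg -hg'; congr (autMap _ phi); apply: lrmorphism_inj => a.
  (* h(a) = x(h(a) (x) 1) is a value of the pairing of x with g.x, so it depends only on these two
     points. *)
  have [z zE] := surj_cs (pure a 1).
  have xh (f : {lrmorphism A -> L}) : x (tensorf f (pure a 1)) = f a.
    by rewrite tensorf_pure specPt_pure pure11 rmorph1 mulr1.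
  by rewrite -!xh -zE !coshear_eval hg hg' gx.
move=> [y x] _; have /choice[inv invE] := surj_cs.
pose P := specPt_pair x y.
have invK z : inv (coshear phi z) = z := inj_cs _ _ (invE (coshear phi z)).
have invD w w' : inv (w + w') = inv w + inv w'.
  by apply: inj_cs; rewrite [LHS]invE rmorphD; congr (_ + _); rewrite [RHS]invE.
have invM w w' : inv (w * w') = inv w * inv w'.
  by apply: inj_cs; rewrite [LHS]invE rmorphM; congr (_ * _); rewrite [RHS]invE.
have inv_pure b : inv (pure 1 b) = b *: 1.
  apply: inj_cs; rewrite [LHS]invE [RHS]coshearZ.
  by rewrite rmorph1 mulr1.
have Pinv_pure b : P (inv (pure 1 b)) = x (pure 1 b) :> L.
  by rewrite inv_pure [LHS]specPt_pairZ rmorph1 mulr1.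
(* The map A (x) K -> L sought is [P] after [inv]; h is its restriction to A, and its restriction to
   K is x by [Pinv_pure]. *)
pose h (a : A) : L := P (inv (pure a 1)).
have hB : zmod_morphism h.
  move=> a b; apply/(canRL (addrK _)); rewrite /h -[LHS](rmorphD P) -invD -pureDl.
  by rewrite subrK.
have hM : monoid_morphism h.
  split=> [|a b]; first by rewrite /h Pinv_pure pure11 rmorph1.
  by rewrite /h -[1 in LHS]mulr1 pureM invM; apply: (rmorphM P).
(* The scalar c is moved to the factor K, where [Pinv_pure] applies. *)
have hZ : scalable h.
  move=> c a; rewrite /h -pureZr.
  rewrite -[pure a _](_ : pure 1 c%:A * pure a 1 = _); last first.
    by rewrite -pureM mul1r mulr1.
  transitivity (x (pure 1 c%:A) * (P (inv (pure a 1)) : L)).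
    by rewrite -Pinv_pure invM; apply: (rmorphM P).
  rewrite pureZr specPt_pure pure11 rmorph1 mulr1; exact: (mulr_algl c (h a)).
pose hl : {lrmorphism A -> L} := HB.pack h
  (GRing.isZmodMorphism.Build _ _ h hB) (GRing.isMonoidMorphism.Build _ _ h hM)
  (GRing.isScalable.Build _ _ _ _ h hZ).
have hP w : x (tensorf hl w) = P (inv w) :> L.
  elim/tensor_ind: w => [b|a w IH|w w' IH IH'].
  - by rewrite tensorf_pure rmorph1 Pinv_pure.
  - have -> : a *: w = pure a 1 * w.
      by rewrite [pure a 1]pure1l pure11 -scalerAl mul1r.
    transitivity ((h a : L) * P (inv w)); last first.
      by rewrite invM; apply/esym/(rmorphM P).
    rewrite -IH tensorfM tensorf_pure.
    transitivity (x (pure (h a) 1) * x (tensorf hl w)); first exact: (rmorphM x).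
    by rewrite specPt_pure pure11 rmorph1 mulr1.
  - transitivity ((P (inv w) : L) + P (inv w')); last first.
      by rewrite invD; apply/esym/(rmorphD P).
    by rewrite -IH -IH' tensorfD; apply: (rmorphD x).
exists (exist _ (autMap hl phi) (H_fun hl I), x) => //.
congr pair; apply: specPt_ext => b.
transitivity (specPt_pair x (specAct (autMap hl phi) x) (pure 1 b) : L).
  by rewrite specPt_pairE.
by rewrite -coshear_eval hP invK [LHS]specPt_pairE.
Qed.

(** When y = x o t, the pairing is a (x) b |-> a t(b) followed by x. The first map is coordinate t
    of K (x) K = K^G at the identity point of Spec K. *)
Lemma specPt_pair_gal (k : fieldType) (K : splittingFieldType k)
    (L : comAlgType k) (x y : specPt K L) (t : gal_of {:K}) :
    (forall b, y (pure 1 b) = x (pure 1 (t b))) ->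
  forall z, specPt_pair x y z
    = x (pure 1 (galCoord (specPt_of (idfun : {lrmorphism K -> K})) z t)) :> L.
Proof.
move=> yx z; elim/tensor_ind: z => [b|a z IH|z w IHz IHw].
- rewrite specPt_pairE yx /galCoord (autConstE (algAut_gal t)).
  by rewrite [specPt_of _ _]specPt_ofE mul1r.
- rewrite [LHS]specPt_pairZ IH /galCoord !linearZ /=.
  exact/esym/(rmorphM (specPt_res x)).
- rewrite [LHS](rmorphD (specPt_pair x y)) [X in X + _ = _]IHz [X in _ + X = _]IHw.
  by rewrite /galCoord !linearD /= pureDr linearD.
Qed.

(** * The orbit of one ks-point and the torsor property *)

Theorem theorem4p3 (k : fieldType) (K : splittingFieldType k)
    (galK : galois 1%VS {:K}) (degK : (2 < \dim {:K})%N)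
    (ks : fieldType) (iota : {rmorphism k -> ks}) (ksP : separable_closure iota)
    (Gbar : subgroupFunctor K) (etaleG : finite_etale Gbar)
    (GbarE : Gbar (algAlong iota)
             = centralizer (range (@autConst k K (algAlong iota)))) :
  is_torsor Gbar.
Proof.
have [A [etaleA [eta [eta_nat eta_bij]]]] := etaleG.
pose phi : autPt K A := eta A (idfun : {lrmorphism A -> A}).
have etaE (L : comAlgType k) (h : {lrmorphism A -> L}) : eta L h = autMap h phi.
  by rewrite -eta_nat; congr (eta L _); apply: lrmorphism_inj.
have Gbar_bij (L : comAlgType k) :
    set_bij setT (Gbar L) (fun h : {lrmorphism A -> L} => autMap h phi).
  by have := eta_bij L; congr (set_bij _ _ _); apply/funext => h; rewrite etaE.
pose L : comAlgType k := algAlong iota; have [L_fun L_inj L_surj] := Gbar_bij L.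
have [_ sepK _] := and3P galK.
have [f _] := separable_embeddings ksP sepK.
pose x : specPt K L := specPt_of (f (Ordinal (ltnW (ltnW degK)))).
(* [c] is the orbit map of x, read in G: ks is a field, so each translate of x is some x o t. *)
have /choice[c cE] (h : {lrmorphism A -> L}) :
    exists t : gal_of {:K}, forall b,
      specAct (autMap h phi) x (pure 1 b) = x (pure 1 (t b)).
  apply: (@rmorphism_gal k K ks (specPt_res x)
    (specPt_res (specAct (autMap h phi) x)) galK) => r.
  exact: etrans (rmorph_alg (specPt_res x) r)
    (esym (rmorph_alg (specPt_res _) r)).
have c_inj : injective c.
  move=> h h' hh'; apply: L_inj; rewrite ?inE //.
  apply: (centralizer_free galK (x := x)); rewrite -?GbarE; try exact: L_fun.
  by apply: specPt_ext => b; rewrite !cE hh'.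
have [d [a [led spanA]]] := etale_spanning ksP etaleA c_inj.
rewrite card_gal_of // in led.
have cs_inj : injective (coshear phi).
  apply: raddf_inj => z z0.
  pose y : specPt K K := specPt_of (idfun : {lrmorphism K -> K}).
  apply: (bij_inj (galCoord_bij galK y)); apply/funext => t.
  (* Some h moves x to x o t, so x kills coordinate t of z, and x is injective on K. *)
  have [psi Cpsi psiE] := centralizer_transitive galK x t.
  rewrite -GbarE in Cpsi; have [h _ hpsi] := L_surj _ Cpsi.
  have := coshear_eval phi h x z.
  rewrite {}z0 hpsi (specPt_pair_gal psiE) /tensorf (map_mx0 h) (linear0 x).
  move/esym/eqP; rewrite [_ == _](fmorph_eq0 (specPt_res x : {rmorphism K -> ks})).
  by move/eqP; rewrite /galCoord !linear0.
exact: torsor_of_coshear Gbar_bij cs_inj (coshear_surj led spanA cs_inj).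
Qed.
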